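(* Let $\lambda$ be a peak partition with its last part greater than $1$. The map $$g_\lambda:\mathrm{SPYT}(\lambda)\to\mathrm{SVT}(\lambda'_-,\rho_{\lambda_1-1}),\qquad T\mapsto\mathfrak r(\mathfrak m_{\rm c}(T)),$$ is a bijection. Furthermore, the diagram $$\begin{array}{ccccc} \widehat{\mathrm{SYCT}(\lambda)} & \xrightarrow{\ f_\lambda\ } & \mathrm{SYT}(\lambda) & \xrightarrow{\ \mathfrak r\ } & \mathrm{SYT}(\lambda')\\ {\scriptstyle\iota}\uparrow & & {\scriptstyle\iota}\uparrow & & \downarrow{\scriptstyle\mathfrak m_{\rm r}}\\ \widehat{\mathrm{SPYCT}(\lambda)} & \xrightarrow{\ f_\lambda|\ } & \mathrm{SPYT}(\lambda) & \xrightarrow{\ g_\lambda\ } & \mathrm{SVT}(\lambda'_-,\rho_{\lambda_1-1}) \end{array}$$ is commutative, where the $\iota$'s are the natural injections.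
   Context: A composition $\alpha=(\alpha_1,\dots,\alpha_k)$ of $n$ is a finite list of positive integers with sum $n$; $\lambda(\alpha)$ is the partition obtained by sorting its parts into weakly decreasing order. The diagram $D(\alpha)$ is the left-justified array with $\alpha_i$ boxes in row $i$, rows numbered from bottom to top; box $(i,j)$ lies in column $i$ and row $j$, and $T_{i,j}$ is the entry of $T$ there. A peak composition is a composition all of whose parts, except possibly the last, are greater than $1$; a peak partition is a partition that is also a peak composition. $\lambda'=(\lambda'_1,\lambda'_2,\dots,\lambda'_{\lambda_1})$ is the conjugate partition of $\lambda$. $\mathrm{SYT}(\lambda)$: standard Young tableaux of shape $\lambda$ (rows increase left to right, columns increase bottom to top). $\mathrm{SPYT}(\lambda)$ (standard peak Young tableaux): those $T\in\mathrm{SYT}(\lambda)$ such that for every $1\le k\le n=|\lambda|$ the boxes with entries at most $k$ form the diagram of a peak composition. $\mathrm{SYCT}(\alpha)$: fillings of $D(\alpha)$ with $1,\dots,n$ (each once), rows increasing left to right, first column increasing bottom to top, such that whenever $i<j$, $(k,j),(k+1,i)\in D(\alpha)$ and $T_{k,j}\le T_{k+1,i}$, then $(k+1,j)\in D(\alpha)$ and $T_{k+1,j}<T_{k+1,i}$. $\mathrm{SPYCT}(\alpha)$ ($\alpha$ a peak composition): those $T\in\mathrm{SYCT}(\alpha)$ such that for every $k$ the boxes with entries $\le k$ form the diagram of a peak composition. $\widehat{\mathrm{SYCT}(\lambda)}$ is the union of $\mathrm{SYCT}(\alpha)$ over compositions $\alpha$ with $\lambda(\alpha)=\lambda$, and $\widehat{\mathrm{SPYCT}(\lambda)}$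 the union of $\mathrm{SPYCT}(\alpha)$ over peak compositions $\alpha$ with $\lambda(\alpha)=\lambda$. $f_\lambda:\widehat{\mathrm{SYCT}(\lambda)}\to\mathrm{SYT}(\lambda)$ sends $T$ to the tableau of shape $\lambda$ whose $i$th column consists of the entries of the $i$th column of $T$ in increasing order from bottom to top. $f_\lambda|$ is its restriction to $\widehat{\mathrm{SPYCT}(\lambda)}$, whose image is $\mathrm{SPYT}(\lambda)$. For a partition $\mu=(\mu_1,\dots,\mu_k)$ and a composition $\rho=(\rho_1,\dots,\rho_k)$, $\mathrm{SVT}(\mu,\rho)$ is the set of standard set-valued Young tableaux of shape $\mu$ and density $\rho$: fillings of $D(\mu)$ by sets that use each element of $\{1,\dots,\sum_i\mu_i\rho_i\}$ exactly once, with every box in row $j$ containing exactly $\rho_j$ integers, every integer in $(i,j)$ smaller than every integer in $(i,j+1)$, and every integer in $(i,j)$ smaller than every integer in $(i+1,j)$ (whenever these boxes exist). For a standard Young tableau $T$, $\mathfrak m_{\rm c}(T)$ (resp. $\mathfrak m_{\rm r}(T)$) is the tableau obtained from $T$ by merging the first and second columns (resp. rows), so that box $(1,i)$ (resp. $(i,1)$) of the new filling contains $T_{1,i}$ and $T_{2,i}$ (resp. $T_{i,1}$ and $T_{i,2}$) if they exist, the remaining columns (resp. rows) being shifted by one. The paper regards $\mathfrak m_{\rm c}$ and $\mathfrak m_{\rm r}$, for a fixed shape, as functions from the set of standard Young tableaux of that shape to the set of standard set-valued Young tableaux of a certain shape and density. $\mathfrak r(T)$ is the reflection of a (possibly set-valued)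 tableau $T$ along the line $y=x$. For $\lambda$ with last part greater than $1$, $\lambda'_-=(\lambda'_1,\lambda'_3,\lambda'_4,\dots,\lambda'_{\lambda_1})$. For a positive integer $s$, $\rho_s=(2,1,1,\dots,1)$ has length $s$.
   Formalization: The arrow m_r does not always land in SVT (for λ=(2,2), rows 12/34 give boxes {1,3},{2,4}), so its codomain is enlarged to set-valued fillings of the same shape and density without order conditions, and the right square commutes after including SVT into these fillings. *)

(* Defs.v *)
From mathcomp Require Import all_boot finmap boolp classical_sets.

Set Implicit Arguments.
Unset Strict Implicit.
Unset Printing Implicit Defensive.

Local Open Scope fset_scope.
Local Open Scope classical_set_scope.

(* Compositions are lists of parts, the bottom row of the diagram first. *)
Definition composition (alpha : seq nat) : bool := all (leq 1) alpha.

Definition peak_composition (alpha : seq nat) : bool :=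
  composition alpha && all (leq 2) (take (size alpha).-1 alpha).

Definition partition (lam : seq nat) : bool :=
  composition lam && sorted geq lam.

Definition peak_partition (lam : seq nat) : bool :=
  partition lam && peak_composition lam.

Definition sorted_partition (alpha : seq nat) : seq nat := sort geq alpha.

Definition conj_partition (lam : seq nat) : seq nat :=
  [seq count (leq i.+1) lam | i <- iota 0 (head 0 lam)].

(* The conjugate partition without its second part. *)
Definition conj_partition_minus (lam : seq nat) : seq nat :=
  take 1 (conj_partition lam) ++ drop 2 (conj_partition lam).

(* The list (2, 1, ..., 1) of length s, for s > 0. *)
Definition rho (s : nat) : seq nat := 2 :: nseq s.-1 1.

(* Columns and rows are numbered from 0: column i, row j here is the box     *)
(* (i + 1, j + 1) in the usual numbering. Entries are still 1, ..., n.       *)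
Definition in_diagram (alpha : seq nat) (i j : nat) : bool :=
  i < nth 0 alpha j.

(* [T i j] is the content of the box in column i and row j, and [None] if    *)
(* there is no such box, so that equality of fillings is Leibniz equality.   *)
Definition filling (A : Type) := nat -> nat -> option A.

Definition has_shape (A : Type) (alpha : seq nat) (T : filling A) : Prop :=
  forall i j, isSome (T i j) = in_diagram alpha i j.

Definition uses_once (n : nat) (T : filling nat) : Prop :=
  (forall i j a, T i j = Some a -> 1 <= a <= n) /\
  (forall a, 1 <= a <= n -> exists! b : nat * nat, T b.1 b.2 = Some a).

Definition rows_increase (T : filling nat) : Prop :=
  forall i i' j a b, i < i' -> T i j = Some a -> T i' j = Some b -> a < b.

Definition column_increases (T : filling nat) (i : nat) : Prop :=
  forall j j' a b, j < j' -> T i j = Some a -> T i j' = Some b -> a < b.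

Definition SYT (lam : seq nat) : set (filling nat) :=
  [set T | [/\ has_shape lam T, uses_once (sumn lam) T,
               rows_increase T & forall i, column_increases T i]].

Definition entry_le (T : filling nat) (k i j : nat) : bool :=
  if T i j is Some a then a <= k else false.

Definition peak_condition (n : nat) (T : filling nat) : Prop :=
  forall k, 1 <= k <= n ->
    exists2 beta, peak_composition beta &
      forall i j, entry_le T k i j = in_diagram beta i j.

Definition SPYT (lam : seq nat) : set (filling nat) :=
  [set T | SYT lam T /\ peak_condition (sumn lam) T].

Definition triple_condition (T : filling nat) : Prop :=
  forall i j k a b, i < j -> T k j = Some a -> T k.+1 i = Some b -> a <= b ->
    exists2 c, T k.+1 j = Some c & c < b.

Definition SYCT (alpha : seq nat) : set (filling nat) :=
  [set T | [/\ has_shape alpha T, uses_once (sumn alpha) T,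
               rows_increase T, column_increases T 0 & triple_condition T]].

Definition SPYCT (alpha : seq nat) : set (filling nat) :=
  [set T | SYCT alpha T /\ peak_condition (sumn alpha) T].

Definition SYCT_hat (lam : seq nat) : set (filling nat) :=
  [set T | exists alpha,
     [/\ composition alpha, sorted_partition alpha = lam & SYCT alpha T]].

Definition SPYCT_hat (lam : seq nat) : set (filling nat) :=
  [set T | exists alpha,
     [/\ peak_composition alpha, sorted_partition alpha = lam
       & SPYCT alpha T]].

(* The entries of column i; a filling in SYCT_hat lam has size lam rows. *)
Definition column_entries (lam : seq nat) (T : filling nat) (i : nat) :
  seq nat := pmap (T i) (iota 0 (size lam)).

Definition f_map (lam : seq nat) (T : filling nat) : filling nat :=
  fun i j => onth (sort leq (column_entries lam T i)) j.

(* Set-valued fillings of shape mu and density r (row j having nth 0 r j     *)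
(* integers in each box), without any order condition.                       *)
Definition SVF (mu r : seq nat) : set (filling {fset nat}) :=
  let n := \sum_(j < size mu) nth 0 mu j * nth 0 r j in
  [set S | [/\ has_shape mu S,
      forall i j X, S i j = Some X -> #|` X| = nth 0 r j,
      forall i j X a, S i j = Some X -> a \in X -> 1 <= a <= n
    & forall a, 1 <= a <= n ->
        exists! b : nat * nat, exists2 X, S b.1 b.2 = Some X & a \in X]].

Definition fset_lt (X Y : {fset nat}) : Prop :=
  forall a b, a \in X -> b \in Y -> a < b.

Definition SVT (mu r : seq nat) : set (filling {fset nat}) :=
  [set S | [/\ SVF mu r S,
      forall i j X Y, S i j = Some X -> S i j.+1 = Some Y -> fset_lt X Y
    & forall i j X Y, S i j = Some X -> S i.+1 j = Some Y -> fset_lt X Y]].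

Definition merge_boxes (x y : option nat) : option {fset nat} :=
  match x, y with
  | Some a, Some b => Some [fset a; b]
  | Some a, None => Some [fset a]
  | None, Some b => Some [fset b]
  | None, None => None
  end.

Definition merge_columns (T : filling nat) : filling {fset nat} :=
  fun i j => if i is i'.+1 then omap (fun a => [fset a]) (T i'.+2 j)
             else merge_boxes (T 0 j) (T 1 j).

Definition merge_rows (T : filling nat) : filling {fset nat} :=
  fun i j => if j is j'.+1 then omap (fun a => [fset a]) (T i j'.+2)
             else merge_boxes (T i 0) (T i 1).

Definition reflect_filling (A : Type) (T : filling A) : filling A :=
  fun i j => T j i.

(* u : X -> Y is the map between the subsets X and Y given by h; with h the  *)
(* identity, u is the inclusion of X in Y.                                   *)
Definition induced_by (A B : Type) (X : set A) (Y : set B) (h : A -> B)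
    (u : X -> Y) : Prop :=
  forall x : X, val (u x) = h (val x).

(* Main.v *)
(** When all rows have at least two boxes, a standard tableau T is in SPYT iff
    T 1 j < T 0 j.+1 for all j, and this is the only inequality between merged
    boxes that standardness does not give. Splitting each two-element box into
    its minimum and its maximum is therefore inverse to merging. For f_map, the
    j-th smallest entry of a column (counting from 0) is less than b iff more
    than j entries of this column are less than b, so both the row condition and
    the peak condition for f_map reduce to comparing the numbers of small
    entries in two adjacent columns. *)

Require Import Defs.
From mathcomp Require Import all_boot finmap boolp classical_sets.

Set Implicit Arguments.
Unset Strict Implicit.
Unset Printing Implicit Defensive.

(** * Diagrams, counting and conjugate partitions *)

(** A down-closed set of naturals below [N] is an initial segment, so its cardinality decides
    membership. Row and column lengths are read off in this way. *)
Lemma count_down_closed (p : pred nat) (N : nat) :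
  (forall i, p i.+1 -> p i) -> (forall i, p i -> i < N) ->
  forall i, (i < count p (iota 0 N)) = p i.
Proof.
elim: N p => [|N IHN] p pS pN i; first by apply/esym/negP => /pN.
rewrite /= (iotaDl 1 0 N : iota 1 N = _) count_map.
have pSN j : p j.+1 -> j < N by move=> /pN.
have cE := IHN (p \o S) (fun j => pS j.+1) pSN.
rewrite -[count _ (iota 0 N)]/(count (p \o S) (iota 0 N)).
have p0 j : p j -> p 0 by elim: j => // j IHj /pS.
case p0E: (p 0); last first.
  have -> : count (p \o S) (iota 0 N) = 0.
    by apply/eqP; rewrite -leqn0 leqNgt cE /=; apply/negP => /pS; rewrite p0E.
  by rewrite ltn0; apply/esym/negP => /p0; rewrite p0E.
by case: i => [|i]; rewrite ?p0E // add1n ltnS cE.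
Qed.

Lemma count_in_diagram (s : seq nat) (N i : nat) : size s <= N ->
  count (in_diagram s i) (iota 0 N) = count (leq i.+1) s.
Proof.
move=> /subnKC <-; rewrite iotaD count_cat add0n.
have -> : count (in_diagram s i) (iota (size s) (N - size s)) = 0.
  apply/eqP; rewrite -leqn0 leqNgt -has_count; apply/hasPn => j.
  by rewrite mem_iota /in_diagram => /andP[sj _]; rewrite nth_default.
by rewrite addn0 -[in RHS](mkseq_nth 0 s) count_map.
Qed.

Lemma in_diagram_size (s : seq nat) (i j : nat) :
  in_diagram s i j -> j < size s.
Proof.
by rewrite /in_diagram ltnNge; case: leqP => // sj; rewrite nth_default.
Qed.

Lemma in_diagram_left (s : seq nat) (i j : nat) :
  in_diagram s i.+1 j -> in_diagram s i j.
Proof. exact: ltnW. Qed.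

Lemma in_diagram_down (s : seq nat) (i j : nat) : sorted geq s ->
  in_diagram s i j.+1 -> in_diagram s i j.
Proof.
move=> ss ij; have := in_diagram_size ij; rewrite /in_diagram => sj.
by apply: leq_trans ij _; exact: (sortedP 0 ss).
Qed.

Lemma mem_le_head (s : seq nat) (x : nat) : sorted geq s -> x \in s ->
  x <= head 0 s.
Proof.
case: s => //= y s ys; rewrite inE => /predU1P[-> //|xs].
have /allP := order_path_min (rev_trans leq_trans) ys; exact.
Qed.

Lemma nth_conj (lam : seq nat) (i : nat) : sorted geq lam ->
  nth 0 (conj_partition lam) i = count (leq i.+1) lam.
Proof.
move=> ss; case: (ltnP i (head 0 lam)) => hi.
  by rewrite (nth_map 0) ?size_iota // nth_iota.
rewrite nth_default ?size_map ?size_iota //; apply/esym/eqP.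
rewrite -leqn0 leqNgt -has_count; apply/hasPn => x; rewrite -leqNgt => lx.
exact: leq_trans (mem_le_head ss lx) hi.
Qed.

(** Since the parts decrease, the rows that meet column [j] form an initial segment, whose length is
    part [j] of the conjugate. *)
Lemma in_diagram_conj (lam : seq nat) (i j : nat) : sorted geq lam ->
  in_diagram (conj_partition lam) i j = in_diagram lam j i.
Proof.
move=> ss; rewrite {1}/in_diagram nth_conj // -(count_in_diagram j (leqnn _)).
rewrite count_down_closed // => k.
  exact: in_diagram_down.
exact: in_diagram_size.
Qed.

Lemma sumn_conj (lam : seq nat) : sorted geq lam ->
  sumn (conj_partition lam) = sumn lam.
Proof.
move=> ss; rewrite !sumnE big_map.
under eq_bigr do rewrite -sum1_count big_mkcond.
rewrite exchange_big big_seq [RHS]big_seq; apply: eq_bigr => x lx /=.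
(* Double counting of the boxes: a part [x] meets exactly [x] columns, all of them counted because
   [x] is at most the first part. *)
rewrite -big_mkcond sum1_count -size_filter (@filter_iota_ltn 0 _ x) ?size_iota //.
exact: mem_le_head ss lx.
Qed.

(** * Entries of fillings and of sorted lists *)

Lemma entry_inj (n : nat) (T : filling nat) (i j i' j' a : nat) :
  uses_once n T -> T i j = Some a -> T i' j' = Some a -> (i, j) = (i', j').
Proof.
move=> [rT /(_ a) uT] Ta Ta'; have [b [_ bP]] := uT (rT _ _ _ Ta).
by rewrite -(bP (i, j) Ta) -(bP (i', j') Ta').
Qed.

(** The boxes of a line have no gaps, so comparisons of neighbours chain together. *)
Lemma opt_increasing (u : nat -> option nat) :
  (forall i, u i.+1 -> u i) ->
  (forall i a b, u i = Some a -> u i.+1 = Some b -> a < b) ->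
  forall i i' a b, i < i' -> u i = Some a -> u i' = Some b -> a < b.
Proof.
move=> uS u_lt i i' a b ii' ua; elim: i' b ii' => // i' IHi b.
rewrite ltnS leq_eqVlt => /predU1P[<-|ii'] ub; first exact: u_lt ua ub.
have := uS i'; rewrite ub => /(_ isT); case uc: (u i') => [c|] // _.
exact: ltn_trans (IHi _ ii' uc) (u_lt _ _ _ uc ub).
Qed.

Lemma entry_leP (T : filling nat) (k i j : nat) :
  reflect (exists2 a, T i j = Some a & a <= k) (entry_le T k i j).
Proof.
rewrite /entry_le; case: (T i j) => [a|]; last by right=> -[].
by apply: (iffP idP) => [ak|[_ [<-]]//]; exists a.
Qed.

(** In a strictly increasing list the elements below [b] form a prefix. *)
Lemma sorted_ltn_onth (s : seq nat) (j a b : nat) :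
  sorted ltn s -> onth s j = Some a ->
  (a < b) = (j < count (fun x => x < b) s).
Proof.
elim: s j => [|x s IHs] j; first by rewrite onth0n.
rewrite [sorted _ _]/= => xs /=.
have /allP xmin := order_path_min ltn_trans xs.
have cs0 : b <= x -> count (fun y => y < b) s = 0.
  move=> bx; apply/eqP; rewrite -leqn0 leqNgt -has_count; apply/hasPn => y sy.
  by rewrite -leqNgt; exact: leq_trans bx (ltnW (xmin _ sy)).
case: j => [[<-]|j sa]; first by case: (ltnP x b) => // /cs0 ->.
case: (ltnP x b) => [xb|bx]; first by rewrite add1n ltnS (IHs j (path_sorted xs) sa).
rewrite cs0 // ltn0; apply: negbTE; rewrite -leqNgt (leq_trans bx) // ltnW //.
by apply: xmin; apply/onthP; exists j.
Qed.

(** * Sorting the columns of a composition tableau *)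

Section Columns.
Variables (lam : seq nat) (T : filling nat).

Lemma mem_column_entries (i a : nat) :
  a \in column_entries lam T i -> exists j, T i j = Some a.
Proof. by rewrite mem_pmap => /mapP[j _ ->]; exists j. Qed.

Lemma count_column_entries (p : pred nat) (i : nat) :
  count p (column_entries lam T i) =
  count (fun j => if T i j is Some a then p a else false) (iota 0 (size lam)).
Proof.
rewrite /column_entries; elim: (iota _ _) => //= j s <-.
by case: (T i j).
Qed.

Lemma count_le_column_entries (k i : nat) :
  count (fun a => a < k.+1) (column_entries lam T i) =
  count (entry_le T k i) (iota 0 (size lam)).
Proof. by rewrite count_column_entries. Qed.

Lemma f_map_mem (i j a : nat) : f_map lam T i j = Some a ->
  a \in column_entries lam T i.
Proof. by move=> fa; rewrite -(mem_sort leq); apply/onthP; exists j. Qed.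

Hypothesis T_once : uses_once (sumn lam) T.

Lemma column_entries_uniq (i : nat) : uniq (column_entries lam T i).
Proof.
rewrite /column_entries; have := iota_uniq 0 (size lam).
elim: (iota _ _) => //= j s IHs /andP[js us].
case Ta: (T i j) => [a|] /=; last exact: IHs.
rewrite IHs // andbT mem_pmap; apply: contraNN js => /mapP[j' sj' Ta'].
by have [->] := entry_inj T_once Ta (esym Ta').
Qed.

Lemma f_map_sorted (i : nat) : sorted ltn (sort leq (column_entries lam T i)).
Proof.
rewrite ltn_sorted_uniq_leq sort_uniq column_entries_uniq sort_sorted //.
exact: leq_total.
Qed.

Lemma f_map_lt (i j a b : nat) : f_map lam T i j = Some a ->
  (a < b) = (j < count (fun x => x < b) (column_entries lam T i)).
Proof.
move=> fa; rewrite (sorted_ltn_onth b (f_map_sorted i) fa).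
by rewrite (permP (permEl (perm_sort leq _))).
Qed.

Variable alpha : seq nat.
Hypothesis lam_perm : perm_eq alpha lam.
Hypothesis lam_sorted : sorted geq lam.
Hypothesis T_shape : has_shape alpha T.
Hypothesis T_rows : rows_increase T.

Lemma f_map_shape : has_shape lam (f_map lam T).
Proof.
move=> i j; rewrite /f_map onthTE size_sort size_pmap.
(* The height of column [i] of [T] is the number of parts of [alpha] above [i], which is invariant
   under permuting the parts. *)
have -> : count (fun j => T i j) (iota 0 (size lam)) = count (leq i.+1) lam.
  rewrite -(perm_size lam_perm) -(permP lam_perm) -(count_in_diagram _ (leqnn _)).
  by apply: eq_count => k; rewrite T_shape.
by rewrite -nth_conj // -in_diagram_conj.
Qed.

Lemma f_map_once : uses_once (sumn lam) (f_map lam T).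
Proof.
have fT i j a : f_map lam T i j = Some a -> exists j', T i j' = Some a.
  by move/f_map_mem/mem_column_entries.
split=> [i j a /fT[j' /(proj1 T_once)]//|a /(proj2 T_once)[[i j] [/= Ta _]]].
have /onthP[j0 fa] : a \in sort leq (column_entries lam T i).
  rewrite mem_sort mem_pmap -Ta map_f // mem_iota -(perm_size lam_perm) /=.
  by apply: (@in_diagram_size _ i); rewrite -T_shape Ta.
exists (i, j0); split=> // -[i' j'] /= fa'.
(* Sorting keeps each entry in its column, so a second occurrence of [a] lies in column [i] too, and
   that column has no repetition. *)
have [j1 Ta'] := fT _ _ _ fa'; have [ii' _] := entry_inj T_once Ta Ta'.
rewrite -{i'}ii' in fa' Ta' *; congr (_, _).
apply: (@onth_inj _ (sort leq (column_entries lam T i))).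
- by rewrite sort_uniq column_entries_uniq.
- by rewrite gtn_min -!onthTE; move: fa; rewrite /f_map => ->; rewrite orbT.
- by rewrite fa.
Qed.

Lemma f_map_rows : rows_increase (f_map lam T).
Proof.
move=> i i' j; move: i i'.
have fS k : f_map lam T k.+1 j -> f_map lam T k j.
  by rewrite !f_map_shape; exact: in_diagram_left.
apply: (opt_increasing (u := f_map lam T ^~ j) fS) => i a b fa fb.
rewrite (f_map_lt b fa).
(* As [b] has position [j] in its sorted column, more than [j] entries there are at most [b]; the
   bound [b.+1] includes [b] itself. Their left neighbours in [T] are all below [b]. *)
apply: (@leq_trans (count (fun x => x < b.+1) (column_entries lam T i.+1))).
  by rewrite -(f_map_lt b.+1 fb).
rewrite !count_column_entries; apply: sub_count => k /=.
case Tc: (T i.+1 k) => [c|] //; rewrite ltnS => cb.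
have : T i k by rewrite T_shape; apply: in_diagram_left; rewrite -T_shape Tc.
by case Td: (T i k) => [d|] // _; exact: leq_trans (T_rows (ltnSn i) Td Tc) cb.
Qed.

Lemma f_map_columns (i : nat) : column_increases (f_map lam T) i.
Proof.
move=> j j' a b jj' fa fb; have size_lt k c : f_map lam T i k = Some c ->
    k < size (sort leq (column_entries lam T i)) by rewrite -onthTE /f_map => ->.
rewrite -(onth_nth 0 _ _ _ fa) -(onth_nth 0 _ _ _ fb).
apply: (sorted_ltn_nth ltn_trans 0 (f_map_sorted i)) => //; rewrite inE.
  exact: size_lt fa.
exact: size_lt fb.
Qed.

Lemma f_map_SYT : SYT lam (f_map lam T).
Proof.
split.
- exact: f_map_shape.
- exact: f_map_once.
- exact: f_map_rows.
- exact: f_map_columns.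
Qed.

End Columns.

(** * Peak compositions and the peak condition *)

(** Only the last part can fail to exceed 1. *)
Lemma size_peak_composition (beta : seq nat) : peak_composition beta ->
  size beta <= (count (leq 2) beta).+1.
Proof.
case/andP=> _; rewrite all_count => /eqP b2.
rewrite -[X in count _ X](cat_take_drop (size beta).-1) count_cat b2.
by rewrite size_takel ?leq_pred // -addSn (leq_trans (leqSpred _)) ?leq_addr.
Qed.

Lemma count_composition (beta : seq nat) :
  composition beta -> count (leq 1) beta = size beta.
Proof. by rewrite /composition all_count => /eqP. Qed.

Definition peak_columns (T : filling nat) : Prop :=
  forall j a b, T 1 j = Some a -> T 0 j.+1 = Some b -> a < b.

(** Let [beta] be the composition formed by the entries at most [b]. It has at least [j + 2] parts,
    hence at least [j + 1] parts above 1, so more than [j] entries of column 1 are at most [b]. This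
    gives [a <= b], and equality would put one entry in two columns. *)
Lemma f_map_peak_columns (lam alpha : seq nat) (T : filling nat) :
  perm_eq alpha lam -> has_shape alpha T -> uses_once (sumn lam) T ->
  peak_condition (sumn lam) T -> peak_columns (f_map lam T).
Proof.
move=> lam_perm T_shape T_once T_peak j a b fa fb.
have [j0 Tb] := mem_column_entries (f_map_mem fb).
have [j1 Ta] := mem_column_entries (f_map_mem fa).
have [beta beta_peak betaE] := T_peak b (proj1 T_once _ _ _ Tb).
have cE i : count (fun x => x < b.+1) (column_entries lam T i)
    = count (leq i.+1) beta.
  rewrite count_le_column_entries (eq_count (betaE i)) count_in_diagram //.
  rewrite -(perm_size lam_perm); have /andP[beta_comp _] := beta_peak.
  (* The last row [m] of [beta] is nonempty, hence also a row of [T]; this bounds the number of rows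
     of [beta]. *)
  case E: (size beta) => [//|m].
  have : in_diagram beta 0 m.
    by apply: (allP beta_comp); rewrite mem_nth // E.
  rewrite -betaE => /entry_leP[c Tc _].
  by apply: (@in_diagram_size _ 0); rewrite -T_shape Tc.
have : a < b.+1.
  rewrite (f_map_lt T_once _ fa) cE -ltnS.
  apply: leq_trans (size_peak_composition beta_peak).
  have /andP[/count_composition <- _] := beta_peak.
  by rewrite -cE -(f_map_lt T_once _ fb).
rewrite ltnS leq_eqVlt => /predU1P[ab|//].
by rewrite -ab in Tb; have [] := entry_inj T_once Ta Tb.
Qed.

Section PeakPartition.
Variable lam : seq nat.
Hypothesis lam_sorted : sorted geq lam.
Hypothesis lam_ge2 : all (leq 2) lam.

Lemma in_diagram_ge2 (j : nat) : j < size lam -> in_diagram lam 1 j.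
Proof. by move=> /(mem_nth 0) /(allP lam_ge2). Qed.

Lemma in_diagram10 (j : nat) : in_diagram lam 1 j = in_diagram lam 0 j.
Proof.
by apply/idP/idP => [/in_diagram_left//|/in_diagram_size/in_diagram_ge2].
Qed.

(** If [b] is in row [j.+1], then row [j] is not the last row of entries at most [b], so it has a
    second box there. Conversely, the entries at most [k] are closed to the left and downwards, and
    the inequality gives each row but the top one a second box. *)
Lemma SYT_peak_condition (T : filling nat) : SYT lam T ->
  peak_condition (sumn lam) T <-> peak_columns T.
Proof.
move=> [T_shape T_once T_rows T_columns]; split=> [T_peak j a b Ta Tb|T_peak k _].
  have [beta /andP[_ beta2] betaE] := T_peak b (proj1 T_once _ _ _ Tb).
  have /in_diagram_size : in_diagram beta 0 j.+1 by rewrite -betaE /entry_le Tb.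
  case: beta beta2 betaE => [//|x s] /allP /= beta2 betaE js.
  have : in_diagram (x :: s) 1 j.
    rewrite /in_diagram -(@nth_take (size s)) //; apply: beta2.
    by rewrite mem_nth // size_takel ?leqnSn.
  rewrite -betaE /entry_le Ta leq_eqVlt => /predU1P[ab|//].
  by rewrite -ab in Tb; have [] := entry_inj T_once Ta Tb.
have kleft i j : entry_le T k i.+1 j -> entry_le T k i j.
  move=> /entry_leP[a Ta ak]; have : T i j.
    by rewrite T_shape; apply: in_diagram_left; rewrite -T_shape Ta.
  case Tb: (T i j) => [b|] // _; apply/entry_leP; exists b => //.
  exact: leq_trans (ltnW (T_rows _ _ _ _ _ (ltnSn i) Tb Ta)) ak.
have kdown i j : entry_le T k i j.+1 -> entry_le T k i j.
  move=> /entry_leP[a Ta ak]; have : T i j.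
    by rewrite T_shape; apply: in_diagram_down; rewrite -?T_shape ?Ta.
  case Tb: (T i j) => [b|] // _; apply/entry_leP; exists b => //.
  exact: leq_trans (ltnW (T_columns _ _ _ _ _ (ltnSn j) Tb Ta)) ak.
have kshape i j : entry_le T k i j -> in_diagram lam i j.
  by move=> /entry_leP[a Ta _]; rewrite -T_shape Ta.
have krow j i : (i < count (entry_le T k ^~ j) (iota 0 (head 0 lam)))
    = entry_le T k i j.
  apply: (@count_down_closed (entry_le T k ^~ j)) => {}i; first exact: kleft.
  move/kshape=> ij; apply: (leq_trans ij).
  by apply: mem_le_head => //; rewrite mem_nth // (in_diagram_size ij).
have kcol j : (j < count (entry_le T k 0) (iota 0 (size lam))) = entry_le T k 0 j.
  by apply: count_down_closed => {}j; [exact: kdown|move/kshape/in_diagram_size].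
(* Only the [c] nonempty rows are listed, so that all parts are positive. *)
set c := count (entry_le T k 0) _ in kcol.
exists [seq count (entry_le T k ^~ j) (iota 0 (head 0 lam)) | j <- iota 0 c].
  rewrite /peak_composition /composition all_map; apply/andP; split.
    by apply/allP => j; rewrite mem_iota /= add0n krow -kcol.
  rewrite size_map size_iota -map_take all_map take_iota; apply/allP => j.
  rewrite mem_iota /= add0n leq_min ltn_predRL => /andP[jc _].
  rewrite krow; move: jc; rewrite kcol => /entry_leP[b Tb bk].
  have : T 1 j.
    rewrite T_shape in_diagram10; apply: in_diagram_down => //.
    by rewrite -T_shape Tb.
  case Ta: (T 1 j) => [a|] // _; apply/entry_leP; exists a => //.
  exact: ltnW (leq_trans (T_peak _ _ _ Ta Tb) bk).
move=> i j; rewrite /in_diagram; case: (ltnP j c) => jc.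
  by rewrite (nth_map 0) ?size_iota // nth_iota // krow.
rewrite nth_default ?size_map ?size_iota //; apply/negbTE.
rewrite leqNgt kcol in jc; apply: contraNN jc.
by elim: i => // i IHi /kleft.
Qed.

End PeakPartition.

(** * Reflecting, merging and splitting tableaux *)

Lemma reflect_SYT (lam : seq nat) (T : filling nat) : sorted geq lam ->
  SYT (conj_partition lam) (reflect_filling T) <-> SYT lam T.
Proof.
move=> lam_sorted; rewrite /SYT /= sumn_conj //.
have once_reflect n (U : filling nat) :
    uses_once n U -> uses_once n (reflect_filling U).
  move=> [rU uU]; split=> [i j a /rU//|a /uU[[i j] [/= Ua bU]]].
  by exists (j, i); split=> // -[i' j'] /(bU (j', i'))[-> ->].
split=> -[T_shape T_once T_rows T_columns]; split.
- by move=> i j; rewrite -in_diagram_conj // -T_shape.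
- exact: once_reflect T_once.
- by move=> i i' j; exact: T_columns.
- by move=> i j j'; exact: T_rows.
- by move=> i j; rewrite in_diagram_conj // -T_shape.
- exact: once_reflect T_once.
- by move=> i i' j; exact: T_columns.
- by move=> i j j'; exact: T_rows.
Qed.

(** Sorting gives a finite set a canonical list, from which its minimum and maximum can be read. *)
Lemma sort_fset (X : {fset nat}) (s : seq nat) :
  sorted ltn s -> X =i s -> sort leq X = s.
Proof.
rewrite ltn_sorted_uniq_leq => /andP[us ss] Xs.
apply: (sorted_eq leq_trans anti_leq) => //; first exact: sort_sorted leq_total _.
rewrite perm_sort; apply: uniq_perm => //; exact: fset_uniq.
Qed.

Lemma sort_fset1 (a : nat) : sort leq [fset a]%fset = [:: a].
Proof. by apply: sort_fset => // x; rewrite !inE. Qed.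

Lemma sort_fset2 (a b : nat) : a < b -> sort leq [fset a; b]%fset = [:: a; b].
Proof. by move=> ab; apply: sort_fset => [|x]; rewrite /= ?ab // !inE. Qed.

Lemma cardfs2_ltn (X : {fset nat}) : #|` X| = 2 ->
  exists a b, a < b /\ X = [fset a; b]%fset.
Proof.
have := sort_sorted leq_total X; have := sort_uniq leq X.
have := mem_sort leq X; rewrite -(size_sort leq).
case: (sort leq X) => [|a [|b [|? ?]]] //= memX; rewrite fset_uniq inE andbT.
move=> ab; rewrite andbT leq_eqVlt (negbTE ab) /= => lt_ab _.
by exists a, b; split=> //; apply/fsetP => x; rewrite -memX !inE.
Qed.

(** The truncated predecessor sends both 0 and 1 to 0, so [k.-1] is the merged column of column [k]
    in all cases. *)
Lemma merge_columns_mem (T : filling nat) (i j a : nat) :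
  (exists2 X, merge_columns T i j = Some X & a \in X) <->
  (exists2 k, k.-1 = i & T k j = Some a).
Proof.
case: i => [|i] /=; split.
- case=> X; rewrite /merge_boxes.
  case Tb: (T 0 j) => [b|]; case Tc: (T 1 j) => [c|] // -[<-]; rewrite !inE.
  + by case/orP => /eqP ->; [exists 0|exists 1].
  + by move/eqP ->; exists 0.
  + by move/eqP ->; exists 1.
- case=> -[|[|//]] _ Ta; rewrite /merge_boxes Ta.
  + by case: (T 1 j) => [c|]; [exists [fset a; c]%fset|exists [fset a]%fset];
      rewrite // !inE eqxx.
  + by case: (T 0 j) => [c|]; [exists [fset c; a]%fset|exists [fset a]%fset];
      rewrite // !inE eqxx ?orbT.
- case=> X; case Ta: (T i.+2 j) => [b|] //= [<-]; rewrite inE => /eqP ->.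
  by exists i.+2.
- case=> -[|[|k]] //= [<-] Ta; rewrite Ta /=; exists [fset a]%fset => //.
  by rewrite inE.
Qed.

(* Entry k of row i goes to column k.-1, so columns 0 and 1 are both read off *)
(* from column 0, as the smaller and the larger element of a box.             *)
Definition split_columns (S : filling {fset nat}) : filling nat :=
  fun k i => omap (fun X : {fset nat} => nth 0 (sort leq X) (k == 1)) (S i k.-1).

Section MergedShape.
Variable lam : seq nat.
Hypothesis lam_sorted : sorted geq lam.
Hypothesis lam_ge2 : all (leq 2) lam.
Hypothesis lam_nonempty : 0 < size lam.

Local Notation mu := (conj_partition_minus lam).
Local Notation r := (rho (head 0 lam).-1).

(** The map [bump 1] skips the index 1, that of the deleted column. *)
Lemma in_diagram_minus (i j : nat) :
  in_diagram mu i j = in_diagram lam (bump 1 j) i.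
Proof.
rewrite -(in_diagram_conj i (bump 1 j) lam_sorted) /in_diagram /conj_partition_minus.
by case: (conj_partition lam) => [|x [|y s]]; case: j => [|j];
  rewrite /bump /= ?add1n //= ?drop0 ?nth_nil.
Qed.

(** Columns 0 and 1 have equal heights, so the merged shape still determines both. *)
Lemma in_diagram_pred (k i : nat) :
  in_diagram mu i k.-1 = in_diagram lam k i.
Proof.
rewrite in_diagram_minus; case: k => [|[|k]] //.
by rewrite in_diagram10.
Qed.

Lemma nth_rho (i j : nat) : in_diagram mu i j -> nth 0 r j = (j == 0).+1.
Proof.
rewrite in_diagram_minus; case: j => // j ij; rewrite /= nth_nseq.
(* The index must stay inside the density list, since the default value beyond it is 0. *)
suff -> : j < (head 0 lam).-2 by [].
rewrite -subn2 ltn_subRL; apply: (leq_trans ij).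
by apply: mem_le_head => //; rewrite mem_nth // (in_diagram_size ij).
Qed.

(** The first two columns of [lam] are equally high, so density 2 on the first makes up for the
    deleted second. *)
Lemma sum_minus_rho : \sum_(j < size mu) nth 0 mu j * nth 0 r j = sumn lam.
Proof.
have r_size : size r = size mu.
  have : 1 < head 0 lam.
    by case: lam lam_ge2 lam_nonempty => //= x s /andP[].
  rewrite /= size_nseq size_cat size_take size_drop size_map size_iota.
  by case: (head 0 lam) => [|[|[|n]]].
have c01 : nth 0 (conj_partition lam) 0 = nth 0 (conj_partition lam) 1.
  rewrite !nth_conj //; apply/eq_in_count => x /(allP lam_ge2) x2.
  by rewrite x2 ltnW.
move: r_size c01; rewrite -(sumn_conj lam_sorted) /conj_partition_minus.
case: (conj_partition lam) => [|x [|y s]] //= sE xy.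
  by rewrite big_ord_recl big_ord0 /= xy.
move: sE; rewrite drop0 => -[sE].
rewrite big_ord_recl /= muln2 -addnn -addnA xy; congr (_ + (_ + _)).
rewrite sumnE (big_nth 0) big_mkord; apply: eq_bigr => j _.
have := ltn_ord j; rewrite -[X in _ < X]sE size_nseq => jr.
by rewrite nth_nseq jr muln1.
Qed.

Lemma merge_columns_SVF (T : filling nat) : SYT lam T ->
  SVF mu r (reflect_filling (merge_columns T)).
Proof.
move=> [T_shape T_once T_rows T_columns].
have S_shape : has_shape mu (reflect_filling (merge_columns T)).
  move=> i j; rewrite in_diagram_minus -T_shape /reflect_filling.
  case: j => [|j] /=; last by case: (T j.+2 i).
  by have := T_shape 0 i; have := T_shape 1 i; rewrite in_diagram10 // => <-;
    case: (T 0 i) (T 1 i) => [a|] [b|].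
rewrite /SVF /= sum_minus_rho; split=> //.
- move=> i j X SX; have ij : in_diagram mu i j by rewrite -S_shape SX.
  rewrite (nth_rho ij); case: j SX ij => [|j] SX; rewrite in_diagram_minus => ij.
    move: SX; rewrite /reflect_filling /= /merge_boxes.
    have : T 0 i by rewrite T_shape.
    have : T 1 i by rewrite T_shape in_diagram10.
    case Tb: (T 1 i) => [b|] // _; case Ta: (T 0 i) => [a|] // _ [<-].
    by rewrite cardfs2 (ltn_eqF (T_rows _ _ _ _ _ _ Ta Tb)).
  move: SX; rewrite /reflect_filling /=; case: (T j.+2 i) => //= a [<-].
  exact: cardfs1.
- move=> i j X a SX aX.
  have [k _ /(proj1 T_once)//] : exists2 k, k.-1 = j & T k i = Some a.
  by apply/merge_columns_mem; exists X.
- move=> a /(proj2 T_once)[[k i] /= [Ta uT]]; exists (i, k.-1); split=> /=.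
    by apply/merge_columns_mem; exists k.
  by move=> [i' j'] /= /merge_columns_mem[k' <- /(uT (k', i'))[-> ->]].
Qed.

Lemma merge_columns_SVT (T : filling nat) : SPYT lam T ->
  SVT mu r (reflect_filling (merge_columns T)).
Proof.
move=> [T_SYT T_peak]; split; first exact: merge_columns_SVF.
  move: T_SYT => [T_shape T_once T_rows T_columns] i j X Y SX SY a b aX bY.
  have [k kj Ta] : exists2 k, k.-1 = j & T k i = Some a.
    by apply/merge_columns_mem; exists X.
  have [k' kj' Tb] : exists2 k, k.-1 = j.+1 & T k i = Some b.
    by apply/merge_columns_mem; exists Y.
  apply: T_rows Ta Tb; rewrite ltnNge; apply/negP.
  by case: k k' kj kj' => [|k] [|k'] //= -> ->; rewrite ltnS ltnn.
move: T_peak; rewrite SYT_peak_condition // => T_peak.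
move: T_SYT => [T_shape T_once T_rows T_columns] i j X Y SX SY a b aX bY.
have [k kj Ta] : exists2 k, k.-1 = j & T k i = Some a.
  by apply/merge_columns_mem; exists X.
have [k' kj' Tb] : exists2 k, k.-1 = j & T k i.+1 = Some b.
  by apply/merge_columns_mem; exists Y.
(* The comparison passes through the entry [c] just above [a]. Columns [k] and [k'] both merge into
   [j], so [k' < k] forces [k = 1] and [k' = 0], which is the peak inequality. *)
have : T k i.+1.
  by rewrite T_shape -in_diagram_pred kj -kj' in_diagram_pred -T_shape Tb.
case Tc: (T k i.+1) => [c|] // _; have ac := T_columns _ _ _ _ _ (ltnSn i) Ta Tc.
case: (ltngtP k k') => kk'.
- exact: ltn_trans ac (T_rows _ _ _ _ _ kk' Tc Tb).
- case: k k' kk' kj kj' Ta Tb {Tc} => [//|k] [|k'] /=; last first.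
    by rewrite ltnS => k'k kj kj'; rewrite kj kj' ltnn in k'k.
  by move=> _ -> <- Ta Tb; exact: T_peak Ta Tb.
- by rewrite -kk' Tc in Tb; case: Tb => <-.
Qed.

Lemma split_columnsK (S : filling {fset nat}) : SVF mu r S ->
  reflect_filling (merge_columns (split_columns S)) = S.
Proof.
move=> [S_shape S_card _ _]; apply/funext => i; apply/funext => j.
rewrite /reflect_filling; case SX: (S i j) => [X|]; last first.
  by case: j SX => [|j] SX; rewrite /= /split_columns /= SX.
have := S_card _ _ _ SX; rewrite (@nth_rho i) -?S_shape ?SX //.
case: j SX => [|j] SX.
  move/cardfs2_ltn => [a [b [ab XE]]].
  by rewrite /= /split_columns /= SX /= XE sort_fset2.
move/eqP/cardfs1P => [a XE].
by rewrite /= /split_columns /= SX /= XE sort_fset1.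
Qed.

Lemma merge_columnsK (T : filling nat) : SYT lam T ->
  split_columns (reflect_filling (merge_columns T)) = T.
Proof.
move=> [T_shape _ T_rows _]; apply/funext => k; apply/funext => i.
rewrite /split_columns /reflect_filling; case: k => [|[|k]] /=; last first.
- by case: (T k.+2 i) => //= a; rewrite sort_fset1.
- have : T 1 i = T 0 i :> bool by rewrite !T_shape in_diagram10.
  case Tb: (T 1 i) => [b|]; case Ta: (T 0 i) => [a|] //= _.
  by rewrite sort_fset2 // (T_rows _ _ _ _ _ _ Ta Tb).
- have : T 1 i = T 0 i :> bool by rewrite !T_shape in_diagram10.
  case Tb: (T 1 i) => [b|]; case Ta: (T 0 i) => [a|] //= _.
  by rewrite sort_fset2 // (T_rows _ _ _ _ _ _ Ta Tb).
Qed.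

Lemma split_columns_SPYT (S : filling {fset nat}) : SVT mu r S ->
  SPYT lam (split_columns S).
Proof.
move=> [S_SVF S_rows S_columns].
have S_mem k i a : split_columns S k i = Some a ->
    exists2 X, S i k.-1 = Some X & a \in X.
  by move=> Ta; rewrite -(split_columnsK S_SVF); apply/merge_columns_mem; exists k.
have mem_S i j X a : S i j = Some X -> a \in X ->
    exists2 k, k.-1 = j & split_columns S k i = Some a.
  move=> SX aX; apply/merge_columns_mem; exists X => //.
  by rewrite -SX -[in RHS](split_columnsK S_SVF).
move: S_SVF; rewrite /SVF /= sum_minus_rho => -[S_shape S_card S_range S_once].
have T_shape : has_shape lam (split_columns S).
  move=> k i; rewrite -in_diagram_pred -S_shape /split_columns.
  by case: (S i k.-1).
have lt01 i a b :
    split_columns S 0 i = Some a -> split_columns S 1 i = Some b -> a < b.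
  rewrite /split_columns /=; case SX: (S i 0) => [X|] //=.
  have := S_card _ _ _ SX; rewrite (@nth_rho i) -?S_shape ?SX //.
  by move/cardfs2_ltn => [a' [b' [ab ->]]]; rewrite sort_fset2 //= => -[<-] [<-].
have T_SYT : SYT lam (split_columns S).
  split=> //.
  - split=> [k i a /S_mem[X SX aX]|a /S_once[[i j] /= [[X SX aX] uS]]].
      exact: S_range SX aX.
    have [k kj Ta] := mem_S i j _ _ SX aX; exists (k, i); split=> // -[k' i'] /= Ta'.
    have [ii' kk'] := uS (i', k'.-1) (S_mem _ _ _ Ta'); rewrite -{i'}ii' in Ta' *.
    congr (_, _); rewrite -kj in kk'.
    (* Distinct columns with the same predecessor are 0 and 1, and the minimum and maximum of a box
       differ. *)
    case: k k' {kj} kk' Ta Ta' => [|[|k]] [|[|k']] //=; last by move=> [->].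
      by move=> _ Ta Ta'; have := lt01 _ _ _ Ta Ta'; rewrite ltnn.
    by move=> _ Ta Ta'; have := lt01 _ _ _ Ta' Ta; rewrite ltnn.
  (* Columns 0 and 1 are compared inside one box; any other neighbouring columns come from
     vertically adjacent boxes of [S]. *)
  - move=> k k' i; move: k k'.
    apply: (@opt_increasing (split_columns S ^~ i)) => [k|[|k] a b].
    + by rewrite !T_shape; exact: in_diagram_left.
    + exact: lt01.
    + by move=> /S_mem[X SX aX] /S_mem[Y SY bY]; exact: S_rows SX SY _ _ aX bY.
  - move=> k; apply: opt_increasing => [i|i a b].
    + by rewrite !T_shape; exact: in_diagram_down.
    + move=> /S_mem[X SX aX] /S_mem[Y SY bY].
      exact: S_columns SX SY _ _ aX bY.
(* The two entries to compare lie in horizontally adjacent boxes of the bottom row of [S]. *)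
split=> //; rewrite SYT_peak_condition // => i a b.
by move=> /S_mem[X SX aX] /S_mem[Y SY bY]; exact: S_columns SX SY _ _ aX bY.
Qed.

End MergedShape.

(** * The bijection and the commutative diagram *)

Definition map_of_sub (A B : Type) (X : set A) (Y : set B) (h : A -> B)
    (hXY : forall x, X x -> Y (h x)) : X -> Y :=
  fun x => exist _ (h (val x)) (mem_set (hXY _ (set_valP x))).

Theorem proposition5p9 (lam : seq nat)
    (lam_peak : peak_partition lam) (lam_last : 1 < last 0 lam) :
  let mu := conj_partition_minus lam in
  let r := rho (head 0 lam).-1 in
  exists (f : SYCT_hat lam -> SYT lam) (f_res : SPYCT_hat lam -> SPYT lam)
    (refl : SYT lam -> SYT (conj_partition lam))
    (m_r : SYT (conj_partition lam) -> SVF mu r)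
    (g : SPYT lam -> SVT mu r)
    (iota1 : SPYCT_hat lam -> SYCT_hat lam) (iota2 : SPYT lam -> SYT lam)
    (iota3 : SVT mu r -> SVF mu r),
  [/\ [/\ induced_by (f_map lam) f, induced_by (f_map lam) f_res,
          induced_by (@reflect_filling nat) refl & induced_by merge_rows m_r],
      [/\ induced_by id iota1, induced_by id iota2 & induced_by id iota3],
      induced_by (fun T => reflect_filling (merge_columns T)) g,
      bijective g
    & (forall T, f (iota1 T) = iota2 (f_res T)) /\
      (forall T, m_r (refl (iota2 T)) = iota3 (g T))].
Proof.
move=> mu r.
have /andP[/andP[_ lam_sorted] /andP[_ lam_ge2']] := lam_peak.
have lam_nonempty : 0 < size lam by case: (lam) lam_last.
(* The peak property bounds every part but the last, and [lam_last] bounds that one. *)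
have lam_ge2 : all (leq 2) lam.
  case/lastP: (lam) lam_last lam_ge2' => // s x.
  by rewrite last_rcons size_rcons -cats1 take_size_cat // all_cat /= => -> ->.
have sort_perm alpha : sorted_partition alpha = lam -> perm_eq alpha lam.
  by move=> <-; rewrite perm_sym perm_sort.
have f_SYT T : SYCT_hat lam T -> SYT lam (f_map lam T).
  move=> [alpha [_ /sort_perm lam_perm [T_shape T_once T_rows _ _]]].
  by apply: (f_map_SYT _ lam_perm); rewrite -?(perm_sumn lam_perm).
have SPYCT_SYCT T : SPYCT_hat lam T -> SYCT_hat lam T.
  by move=> [alpha [/andP[alpha_comp _] alphaE [T_SYCT _]]]; exists alpha.
have f_SPYT T : SPYCT_hat lam T -> SPYT lam (f_map lam T).
  move=> T_hat; have fT_SYT := f_SYT _ (SPYCT_SYCT _ T_hat); split=> //.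
  rewrite SYT_peak_condition //.
  move: T_hat => [alpha [_ /sort_perm lam_perm [[T_shape T_once _ _ _] T_peak]]].
  by apply: (f_map_peak_columns lam_perm T_shape);
    rewrite -(perm_sumn lam_perm).
have refl_SYT T : SYT lam T -> SYT (conj_partition lam) (reflect_filling T).
  by rewrite reflect_SYT.
have merge_SVF U : SYT (conj_partition lam) U -> SVF mu r (merge_rows U).
  (* Merging rows is merging columns conjugated by the reflection, up to conversion. *)
  move=> U_SYT; apply: (@merge_columns_SVF lam _ _ _ (reflect_filling U)) => //.
  by rewrite -reflect_SYT.
have g_SVT T : SPYT lam T -> SVT mu r (reflect_filling (merge_columns T)).
  exact: merge_columns_SVT.
have SPYT_SYT T : SPYT lam T -> SYT lam T by case.
have SVT_SVF S : SVT mu r S -> SVF mu r S by case.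
have split_SPYT S : SVT mu r S -> SPYT lam (split_columns S).
  exact: split_columns_SPYT.
exists (map_of_sub f_SYT), (map_of_sub f_SPYT), (map_of_sub refl_SYT),
  (map_of_sub merge_SVF), (map_of_sub g_SVT), (map_of_sub SPYCT_SYCT),
  (map_of_sub SPYT_SYT), (map_of_sub SVT_SVF).
split=> //.
- exists (map_of_sub split_SPYT) => x; apply: val_inj => /=.
    by rewrite (@merge_columnsK lam) //; apply: SPYT_SYT; exact: set_valP.
  by rewrite (@split_columnsK lam) //; apply: SVT_SVF; exact: set_valP.
(* In both squares the two underlying fillings are convertible. *)
- by split=> T; exact: val_inj.
Qed.
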